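(* Let $\mathbf{H}\in\mathbb{R}^{m\times n}$, $\mathbf{y}\in\mathbb{R}^m$, $\mathbf{w}\in\mathcal{K}_{m+}\setminus\{\mathbf{0}\}\subset\mathbb{R}^n$, $\varepsilon>0$, and $f(\mathbf{x})=\tfrac12\|\mathbf{H}\mathbf{x}-\mathbf{y}\|_2^2$. Consider the problem $$\min_{\mathbf{x}\in\mathbb{R}^n} \tfrac12\|\mathbf{y}-\mathbf{H}\mathbf{x}\|_2^2\quad\text{s.t.}\quad \Omega_{\mathbf{w}}(\mathbf{x})\le\varepsilon,$$ with $\mathbf{x}^*$ denoting one of its solutions, and the conditional gradient algorithm with exact line search applied to this problem (described in the context). Then the iterates $\mathbf{x}_k$ of the algorithm satisfy $$f(\mathbf{x}_k)-f(\mathbf{x}^* )\le\frac{8\,\varepsilon^2 L}{\bar{w}^2\,(k+2)},$$ where $L=\lambda_{\max}(\mathbf{H}^T\mathbf{H})$ is the largest eigenvalue of $\mathbf{H}^T\mathbf{H}$ and $\bar{w}=\|\mathbf{w}\|_1/n$ is the average of the weights.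
   Context: $\mathcal{K}_{m+}=\{\mathbf{x}\in\mathbb{R}^n: x_1\ge x_2\ge\cdots\ge x_n\ge 0\}$ is the monotone non-negative cone. The ordered weighted $\ell_1$ (OWL) norm is $\Omega_{\mathbf{w}}(\mathbf{x})=\sum_{i=1}^n w_i\,|x|_{[i]}$, where $|x|_{[1]}\ge\cdots\ge|x|_{[n]}$ are the absolute values of the components of $\mathbf{x}$ sorted in non-increasing order. Let $\mathcal{G}_\varepsilon^{\mathbf{w}}=\{\mathbf{x}\in\mathbb{R}^n:\Omega_{\mathbf{w}}(\mathbf{x})\le\varepsilon\}$. The conditional gradient (Frank–Wolfe) algorithm is initialized with some $\mathbf{x}_0\in\mathcal{G}_\varepsilon^{\mathbf{w}}$ and, for $k=0,1,2,\dots$, computes: $\mathbf{g}_k=\mathbf{H}^T(\mathbf{y}-\mathbf{H}\mathbf{x}_k)$ (the negative gradient $-\nabla f(\mathbf{x}_k)$); $\mathbf{s}_k\in\arg\max_{\mathbf{s}\in\mathcal{G}_\varepsilon^{\mathbf{w}}}\mathbf{s}^T\mathbf{g}_k$; $\gamma_k\in\arg\min_{\gamma\in[0,1]}f(\mathbf{x}_k+\gamma(\mathbf{s}_k-\mathbf{x}_k))$; $\mathbf{x}_{k+1}=\mathbf{x}_k+\gamma_k(\mathbf{s}_k-\mathbf{x}_k)$.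
   Formalization: The bound is stated for the iterates with k ≥ 1 only; at the arbitrary starting point x_0 it is false (m = n = 1, H = 1, w = 1, ε = 1, y = 100, x_0 = −1 gives a gap of 200 against a bound of 4). *)

(* Defs.v *)
From HB Require Import structures.
From mathcomp Require Import all_boot all_order all_algebra.
From mathcomp Require Import boolp classical_sets reals.

Set Implicit Arguments.
Unset Strict Implicit.
Unset Printing Implicit Defensive.

Import Order.TTheory GRing.Theory Num.Theory.

Local Open Scope classical_set_scope.
Local Open Scope ring_scope.

Definition dot (R : realType) (n : nat) (u v : 'cV[R]_n) : R :=
  (u^T *m v) 0 0.

(* The canonical norm `|_| on matrices is the sup norm, hence the explicit
   Euclidean and l1 norms. *)
Definition norm2 (R : realType) (n : nat) (v : 'cV[R]_n) : R :=
  Num.sqrt (\sum_(i < n) v i 0 ^+ 2).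

Definition norm1 (R : realType) (n : nat) (v : 'cV[R]_n) : R :=
  \sum_(i < n) `|v i 0|.

Definition monotone_nonneg_cone (R : realType) (n : nat) : set 'cV[R]_n :=
  [set x | (forall i j : 'I_n, (i <= j)%N -> x j 0 <= x i 0) /\
           (forall i : 'I_n, 0 <= x i 0)].

(* Indices are 0-based: |x|_[i+1] is (sorted_abs x)`_i. *)
Definition sorted_abs (R : realType) (n : nat) (x : 'cV[R]_n) : seq R :=
  sort (fun a b : R => b <= a) [seq `|x i 0| | i <- enum 'I_n].

Definition owl_norm (R : realType) (n : nat) (w x : 'cV[R]_n) : R :=
  \sum_(i < n) w i 0 * (sorted_abs x)`_i.

Definition owl_ball (R : realType) (n : nat) (w : 'cV[R]_n) (eps : R) :
    set 'cV[R]_n :=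
  [set x | owl_norm w x <= eps].

Definition argmin_on (R : realType) (T : Type) (D : set T) (F : T -> R) :
    set T :=
  [set x | D x /\ forall z, D z -> F x <= F z].

Definition argmax_on (R : realType) (T : Type) (D : set T) (F : T -> R) :
    set T :=
  [set x | D x /\ forall z, D z -> F z <= F x].

Definition least_squares (R : realType) (m n : nat) (H : 'M[R]_(m, n))
    (y : 'cV[R]_m) (x : 'cV[R]_n) : R :=
  2^-1 * norm2 (H *m x - y) ^+ 2.

(* Neither the linear subproblem nor the line search need have a unique
   optimizer, so a run is a relation on sequences: any selection of optimizers
   is allowed. *)
Record cg_run (R : realType) (m n : nat) (H : 'M[R]_(m, n)) (y : 'cV[R]_m)
    (w : 'cV[R]_n) (eps : R) (x g s : nat -> 'cV[R]_n) (gamma : nat -> R) :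
    Prop := CgRun {
  cg_init : owl_ball w eps (x 0%N);
  cg_grad : forall k, g k = H^T *m (y - H *m x k);
  cg_lin : forall k, argmax_on (owl_ball w eps) (fun z => dot z (g k)) (s k);
  cg_search : forall k,
    argmin_on [set t : R | 0 <= t <= 1]
      (fun t => least_squares H y (x k + t *: (s k - x k))) (gamma k);
  cg_step : forall k, x k.+1 = x k + gamma k *: (s k - x k)
}.

Definition largest_eigenvalue (R : realType) (n : nat) (A : 'M[R]_n) (L : R) :
    Prop :=
  eigenvalue A L /\ forall a : R, eigenvalue A a -> a <= L.

Definition mean_weight (R : realType) (n : nat) (w : 'cV[R]_n) : R :=
  norm1 w / n%:R.

(* Main.v *)
(* The Chebyshev sum inequality gives [mean_weight w * norm1 z <= owl_norm w z],
   so the ball lies in the l1-ball of radius r = eps / mean_weight w.  The l1-ball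
   is convex, hence contains all iterates, and |s_k - x_k|_2 <= 2 r; the convexity
   of the OWL ball itself is not needed.  As f is quadratic with curvature at most
   L, the gap h_k = f(x_k) - min f satisfies
   h_(k+1) <= (1 - t) h_k + t^2 / 2 * 4 r^2 L for all t in [0, 1], and t = 2 / (k + 2)
   yields the rate by induction.  The curvature bound |H d|^2 <= L |d|^2 holds because
   the least c with H^T H <= c I is an eigenvalue: c I - H^T H is positive
   semidefinite, and would be coercive if it were invertible. *)

Require Import Defs.
From mathcomp Require Import all_boot all_order all_algebra.
From mathcomp Require Import boolp classical_sets reals.
From mathcomp Require Import ring lra.

Import Order.TTheory GRing.Theory Num.Theory.

Local Open Scope ring_scope.

(** * Sum inequalities *)

(** Common source of two inequalities: in both, every summand on the left is nonnegative. Taking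
    [b = d = 1] with [a], [c] ordered alike gives Chebyshev; [c = a], [d = b] gives squares, hence
    Cauchy-Schwarz. *)
Lemma binet_cauchy (R : comNzRingType) (I : finType) (a b c d : I -> R) :
  \sum_i \sum_j (a i * b j - a j * b i) * (c i * d j - c j * d i) =
  2 * ((\sum_i a i * c i) * (\sum_i b i * d i)
       - (\sum_i a i * d i) * (\sum_i b i * c i)).
Proof.
have E (p q : I -> R) :
    (\sum_i p i) * (\sum_i q i) = \sum_i \sum_j p i * q j.
  by rewrite mulr_suml; apply: eq_bigr => i _; rewrite mulr_sumr.
set A := \sum_i a i * c i; set B := \sum_i b i * d i.
set C := \sum_i a i * d i; set D := \sum_i b i * c i.
transitivity (A * B - C * D - D * C + B * A); last by ring.
rewrite !E -!sumrB -big_split; apply: eq_bigr => i _ /=.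
rewrite -!sumrB -big_split; apply: eq_bigr => j _ /=; ring.
Qed.

Lemma chebyshev_sum (R : realFieldType) (n : nat) (a b : 'I_n -> R) :
  (forall i j : 'I_n, (i <= j)%N -> a j <= a i) ->
  (forall i j : 'I_n, (i <= j)%N -> b j <= b i) ->
  (\sum_i a i) * (\sum_i b i) <= n%:R * \sum_i a i * b i.
Proof.
move=> a_noninc b_noninc.
have := @binet_cauchy R 'I_n a (fun=> 1) b (fun=> 1).
have -> : \sum_(i < n) (1 : R) * 1 = n%:R.
  by under eq_bigr do rewrite mulr1; rewrite sumr_const card_ord.
under [\sum_i a i * 1]eq_bigr do rewrite mulr1.
under [\sum_i 1 * b i]eq_bigr do rewrite mul1r.
move=> E; suff : 0 <= \sum_i \sum_j (a i * 1 - a j * 1) * (b i * 1 - b j * 1).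
  by rewrite E => ?; lra.
apply: sumr_ge0 => i _; apply: sumr_ge0 => j _; rewrite !mulr1.
have [ij|/ltnW ji] := leqP i j.
  by rewrite mulr_ge0 // subr_ge0; [exact: a_noninc|exact: b_noninc].
by rewrite mulr_le0 // subr_le0; [exact: a_noninc|exact: b_noninc].
Qed.

Lemma cauchy_schwarz_sum (R : realFieldType) (I : finType) (a b : I -> R) :
  (\sum_i a i * b i) ^+ 2 <= (\sum_i a i ^+ 2) * (\sum_i b i ^+ 2).
Proof.
have : 0 <= \sum_i \sum_j (a i * b j - a j * b i) * (a i * b j - a j * b i).
  by apply: sumr_ge0 => i _; apply: sumr_ge0 => j _; rewrite -expr2 sqr_ge0.
rewrite binet_cauchy pmulr_rge0 // subr_ge0.
by under [\sum_i b i * a i]eq_bigr do rewrite mulrC.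
Qed.

(** * Euclidean inner product *)

Section Dot.
Context {R : realType} {n : nat}.
Implicit Types u v z : 'cV[R]_n.

Lemma dotE u v : dot u v = \sum_i u i 0 * v i 0.
Proof. by rewrite /dot mxE; apply: eq_bigr => i _; rewrite mxE. Qed.

Lemma dotC u v : dot u v = dot v u.
Proof. by rewrite !dotE; apply: eq_bigr => i _; rewrite mulrC. Qed.

Lemma dotDl u v z : dot (u + v) z = dot u z + dot v z.
Proof. by rewrite /dot linearD mulmxDl mxE. Qed.

Lemma dotZl a u v : dot (a *: u) v = a * dot u v.
Proof. by rewrite /dot linearZ -scalemxAl mxE. Qed.

Lemma dotBl u v z : dot (u - v) z = dot u z - dot v z.
Proof. by rewrite -scaleN1r dotDl dotZl mulN1r. Qed.

Lemma dotDr u v z : dot z (u + v) = dot z u + dot z v.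
Proof. by rewrite ![dot z _]dotC dotDl. Qed.

Lemma dotZr a u v : dot u (a *: v) = a * dot u v.
Proof. by rewrite ![dot u _]dotC dotZl. Qed.

Lemma dotBr u v z : dot z (u - v) = dot z u - dot z v.
Proof. by rewrite ![dot z _]dotC dotBl. Qed.

Lemma dot_sqr v : dot v v = \sum_i v i 0 ^+ 2.
Proof. by rewrite dotE. Qed.

Lemma norm2_sqr v : norm2 v ^+ 2 = dot v v.
Proof.
by rewrite /norm2 sqr_sqrtr ?dot_sqr // sumr_ge0 // => i _; rewrite sqr_ge0.
Qed.

Lemma dot_ge0 v : 0 <= dot v v.
Proof. by rewrite -norm2_sqr sqr_ge0. Qed.

Lemma dot0 : dot (0 : 'cV[R]_n) 0 = 0.
Proof. by rewrite dotE big1 // => i _; rewrite mxE mul0r. Qed.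

Lemma dot_eq0 v : (dot v v == 0) = (v == 0).
Proof.
apply/idP/eqP => [|->]; last by rewrite dot0.
rewrite dot_sqr psumr_eq0 => [/allP v0|i _]; last exact: sqr_ge0.
apply/colP => i; rewrite mxE; apply/eqP.
by rewrite -sqrf_eq0; apply: v0; rewrite mem_index_enum.
Qed.

Lemma dot_gt0 v : v != 0 -> 0 < dot v v.
Proof. by move=> v0; rewrite lt_def dot_eq0 v0 dot_ge0. Qed.

End Dot.

Lemma dot_mulmx {R : realType} {m n : nat} (A : 'M[R]_(m, n)) u v :
  dot (A *m u) v = dot u (A^T *m v).
Proof. by rewrite /dot trmx_mul mulmxA. Qed.

(** Cauchy-Schwarz on each row; the constant is the squared Frobenius norm. *)
Lemma dot_mulmx_le {R : realType} {m n : nat} (A : 'M[R]_(m, n)) u :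
  dot (A *m u) (A *m u) <= (\sum_i \sum_j A i j ^+ 2) * dot u u.
Proof.
rewrite !dot_sqr mulr_suml; apply: ler_sum => i _.
by rewrite mxE; exact: cauchy_schwarz_sum.
Qed.

(** * Rayleigh quotients and the largest eigenvalue *)

Section Rayleigh.
Context {R : realType} {n : nat}.
Implicit Types A B : 'M[R]_n.

Lemma quad_form_bound A :
  exists2 M, 0 < M & forall z, dot z (A *m z) <= M * dot z z.
Proof.
pose F := \sum_i \sum_j A i j ^+ 2.
have F0 : 0 <= F.
  by apply: sumr_ge0 => i _; apply: sumr_ge0 => j _; exact: sqr_ge0.
(* Expanding [0 <= |z - A z|^2] bounds twice the form by [|z|^2 + |A z|^2], hence by
   [(1 + F) |z|^2]. *)
exists (1 + F) => [|z]; first by lra.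
have := dot_mulmx_le A z; rewrite -/F.
have := dot_ge0 (z - A *m z).
rewrite dotBl !dotBr [dot (A *m z) z]dotC.
have := dot_ge0 z; have := dot_ge0 (A *m z) => ????; nra.
Qed.

(** Invertibility bounds [|z|^2] by a multiple of [|B z|^2], and positivity bounds [|B z|^2] by a
    multiple of the form. *)
Lemma psd_unitmx_coercive B : B^T = B -> B \in unitmx ->
  (forall z, 0 <= dot z (B *m z)) ->
  exists2 e, 0 < e & forall z, e * dot z z <= dot z (B *m z).
Proof.
move=> Bsym Bu Bpsd.
have [M M0 leM] := quad_form_bound B.
pose F := \sum_i \sum_j invmx B i j ^+ 2.
have F0 : 0 <= F.
  by apply: sumr_ge0 => i _; apply: sumr_ge0 => j _; exact: sqr_ge0.
(* [1 + F] stays positive for [n = 0], where [F] vanishes. *)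
exists (M * (1 + F))^-1 => [|z]; first by rewrite invr_gt0 mulr_gt0 //; lra.
set b := B *m z.
have zb : dot z z <= F * dot b b.
  by have := dot_mulmx_le (invmx B) b; rewrite mulKmx.
(* Positivity at z - b / M, together with (b, B b) <= M |b|^2. *)
have bz : dot b b <= M * dot z b.
  have := Bpsd (z - M^-1 *: b).
  rewrite mulmxBr -scalemxAr -/b dotBl !dotBr !dotZl !dotZr.
  have -> : dot z (B *m b) = dot b b by rewrite -[in RHS]/b dot_mulmx Bsym.
  have := leM b; set p := dot b b; set q := dot z b; set r := dot b _ => rp.
  have : M^-1 * (M^-1 * r) <= M^-1 * p.
    by rewrite ler_pM2l ?invr_gt0 // ler_pdivrMl.
  move=> h1 h2; have : M^-1 * p <= q by lra.
  by rewrite ler_pdivrMl.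
rewrite ler_pdivrMl ?mulr_gt0 //; last by lra.
have := dot_ge0 b => b0.
apply: (le_trans zb); apply: (@le_trans _ _ ((1 + F) * dot b b)); first by lra.
by rewrite [M * _]mulrC -mulrA ler_wpM2l //; lra.
Qed.

Lemma rayleigh_le_max_eigenvalue A L : A^T = A ->
  largest_eigenvalue A L -> forall z, dot z (A *m z) <= L * dot z z.
Proof.
move=> Asym [_ maxL] z.
have [->|z0] := eqVneq z 0; first by rewrite mulmx0 dot0 mulr0.
pose S : set R := fun c => forall u, dot u (A *m u) <= c * dot u u.
have S0 : (S !=set0)%classic by have [M _ SM] := quad_form_bound A; exists M.
(* Each Rayleigh quotient is a lower bound of [S], so [lam] dominates them all and lies in [S]; the
   nonzero [z] ensures that [S] is bounded below. *)
have lbS u : u != 0 -> lbound S (dot u (A *m u) / dot u u).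
  by move=> u0 c Sc; rewrite ler_pdivrMr ?dot_gt0.
pose lam := inf S.
have Slam : S lam.
  move=> u; have [->|u0] := eqVneq u 0.
    by rewrite mulmx0 dot0 mulr0.
  by rewrite -ler_pdivrMr ?dot_gt0 //; apply: lb_le_inf => //; exact: lbS.
suff lamL : lam <= L.
  by apply: (le_trans (Slam z)); rewrite ler_wpM2r ?dot_ge0.
apply: maxL; pose B := lam%:M - A.
have quadB u : dot u (B *m u) = lam * dot u u - dot u (A *m u).
  by rewrite mulmxBl mul_scalar_mx dotBr dotZr.
have Bpsd u : 0 <= dot u (B *m u) by rewrite quadB subr_ge0.
have Bsym : B^T = B by rewrite /B linearB /= tr_scalar_mx Asym.
rewrite /eigenvalue /eigenspace kermx_eq0 row_free_unit.
apply/negP => Au; have Bu : B \in unitmx.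
  by rewrite /B -opprB -scaleN1r unitmxZ // unitrN1.
have [e e0 Be] := psd_unitmx_coercive B Bsym Bu Bpsd.
(* Coercivity of [B] puts [lam - e] in [S], below its infimum. *)
have : lam <= lam - e.
  apply: ge_inf; first by exists (dot z (A *m z) / dot z z); exact: lbS.
  by move=> u; have := Be u; rewrite quadB mulrBl; lra.
by lra.
Qed.

End Rayleigh.

(** * The l1 norm and its comparison with the OWL norm *)

Section Norm1.
Context {R : realType} {n : nat}.
Implicit Types u v w z : 'cV[R]_n.

Lemma norm1D u v : norm1 (u + v) <= norm1 u + norm1 v.
Proof.
by rewrite -big_split; apply: ler_sum => i _; rewrite mxE ler_normD.
Qed.

Lemma norm1Z a u : norm1 (a *: u) = `|a| * norm1 u.
Proof. by rewrite mulr_sumr; apply: eq_bigr => i _; rewrite mxE normrM. Qed.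

Lemma norm1_ge0 u : 0 <= norm1 u.
Proof. by apply: sumr_ge0. Qed.

Lemma dot_le_norm1_sqr u : dot u u <= norm1 u ^+ 2.
Proof.
rewrite dot_sqr expr2 {1}/norm1 mulr_suml; apply: ler_sum => i _.
rewrite -real_normK ?num_real // expr2 ler_wpM2l //.
by rewrite /norm1 (bigD1 i) //= lerDl sumr_ge0.
Qed.

Lemma norm1_gt0 u : u != 0 -> 0 < norm1 u.
Proof.
move=> /dot_gt0 u0; rewrite lt_def norm1_ge0 andbT; apply/eqP => u1.
by have := dot_le_norm1_sqr u; rewrite u1 expr0n /= leNgt u0.
Qed.

Lemma size_sorted_abs u : size (sorted_abs u) = n.
Proof. by rewrite size_sort size_map size_enum_ord. Qed.

Lemma sum_sorted_abs u : \sum_(i < n) (sorted_abs u)`_i = norm1 u.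
Proof.
transitivity (\sum_(a <- sorted_abs u) a).
  by rewrite (big_nth 0) size_sorted_abs big_mkord.
by rewrite (perm_big _ (permEl (perm_sort _ _))) big_map big_enum.
Qed.

Lemma sorted_abs_noninc u (i j : 'I_n) :
  (i <= j)%N -> (sorted_abs u)`_j <= (sorted_abs u)`_i.
Proof.
move=> ij.
have ge_trans : transitive (fun a b : R => b <= a).
  by move=> b a c ba cb; exact: le_trans cb ba.
have S : sorted (fun a b : R => b <= a) (sorted_abs u).
  by apply: sort_sorted => a b; exact: le_total.
by apply: (sorted_leq_nth ge_trans _ 0 S); rewrite ?inE ?size_sorted_abs.
Qed.

Lemma mean_weight_norm1_le_owl_norm w z : monotone_nonneg_cone w ->
  mean_weight w * norm1 z <= owl_norm w z.
Proof.
move=> [w_noninc w_ge0].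
(* For [n = 0] the mean weight is a division by zero, with value 0. *)
have [n0|n0] := posnP n.
  have nR0 : n%:R = 0 :> R by rewrite n0.
  rewrite /mean_weight nR0 invr0 mulr0 mul0r; apply: sumr_ge0 => i _.
  by have := leq_trans (ltn_ord i) (eq_leq n0).
rewrite /mean_weight mulrAC ler_pdivrMr ?ltr0n // [leRHS]mulrC.
have -> : norm1 w = \sum_i w i 0.
  by apply: eq_bigr => i _; rewrite ger0_norm.
rewrite -sum_sorted_abs.
by apply: chebyshev_sum => //; exact: sorted_abs_noninc.
Qed.

End Norm1.

(** * Convergence of the conditional gradient iteration *)

(** Exact second-order expansion: at [xstar - x] it gives convexity, along [s - x] the decrease of a
    step. *)
Lemma least_squaresD {R : realType} {m n : nat} (H : 'M[R]_(m, n))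
    (y : 'cV[R]_m) (x d : 'cV[R]_n) :
  least_squares H y (x + d) =
  least_squares H y x - dot d (H^T *m (y - H *m x))
  + 2^-1 * dot (H *m d) (H *m d).
Proof.
rewrite /least_squares !norm2_sqr -dot_mulmx mulmxDr.
rewrite !(dotBl, dotBr) !(dotDl, dotDr).
rewrite (dotC (H *m d) (H *m x)) (dotC y (H *m x)) (dotC y (H *m d)).
by field.
Qed.

(* The step t = 2 / (k + 2) is used; multiplying the claim by k lets the induction
   start with no bound on h 0. *)
Lemma frank_wolfe_rate {R : realFieldType} (C : R) (h : nat -> R) : 0 <= C ->
  (forall k t, 0 <= t <= 1 -> h k.+1 <= (1 - t) * h k + 2^-1 * t ^+ 2 * C) ->
  forall k, (1 <= k)%N -> h k <= 2 * C / (k%:R + 2).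
Proof.
move=> C0 step.
suff rate k : k%:R * h k <= k%:R * (2 * C / (k%:R + 2)).
  by move=> k k1; have := rate k; rewrite ler_pM2l ?ltr0n.
elim: k => [|k IH]; first by rewrite !mul0r.
rewrite ler_pM2l ?ltr0n //; set q : R := k%:R in IH *.
have q0 : 0 <= q by exact: ler0n.
have q2 : 0 < q + 2 by lra.
have -> : k.+1%:R = q + 1 :> R by rewrite -natr1.
have t01 : 0 <= 2 / (q + 2) <= 1.
  by rewrite divr_ge0 ?(ltW q2) //= ler_pdivrMr //; lra.
apply: (le_trans (step k _ t01)).
have -> : (1 - 2 / (q + 2)) * h k = q * h k / (q + 2) by field; lra.
apply: (@le_trans _ _ (q * (2 * C / (q + 2)) / (q + 2)
    + 2^-1 * (2 / (q + 2)) ^+ 2 * C)).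
  by rewrite lerD2r ler_pM2r ?invr_gt0.
(* The slack is explicit because [(q + 2)^2 - (q + 1) (q + 3) = 1]. *)
rewrite -subr_ge0.
have -> : 2 * C / (q + 1 + 2) - (q * (2 * C / (q + 2)) / (q + 2)
    + 2^-1 * (2 / (q + 2)) ^+ 2 * C) = 2 * C / ((q + 2) ^+ 2 * (q + 3)).
  by field; apply/andP; split; lra.
by rewrite divr_ge0 ?mulr_ge0 ?sqr_ge0 //; lra.
Qed.

Theorem theorem2 (R : realType) (m n : nat)
    (H : 'M[R]_(m, n)) (y : 'cV[R]_m) (w : 'cV[R]_n) (eps L : R)
    (hw : @monotone_nonneg_cone R n w) (hw0 : w <> 0) (heps : 0 < eps)
    (hL : largest_eigenvalue (H^T *m H) L)
    (xstar : 'cV[R]_n)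
    (hxstar : argmin_on (owl_ball w eps) (least_squares H y) xstar)
    (x g s : nat -> 'cV[R]_n) (gamma : nat -> R)
    (hrun : cg_run H y w eps x g s gamma)
    (k : nat) (hk : (1 <= k)%N) :
  least_squares H y (x k) - least_squares H y xstar <=
    8 * eps ^+ 2 * L / (mean_weight w ^+ 2 * (k%:R + 2)).
Proof.
have {hw0} /eqP w0 := hw0.
have n0 : (0 < n)%N.
  by move: w w0 {hw hxstar hrun} => w'; case: (n) w' => // w'; rewrite flatmx0 eqxx.
have wbar0 : 0 < mean_weight w by rewrite divr_gt0 ?norm1_gt0 ?ltr0n.
have curv d : dot (H *m d) (H *m d) <= L * dot d d.
  rewrite dot_mulmx mulmxA; apply: rayleigh_le_max_eigenvalue => //.
  by rewrite trmx_mul trmxK.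
(* The curvature bound at the nonzero vector [w] forces the sign of [L]. *)
have L0 : 0 <= L.
  by rewrite -(pmulr_lge0 _ (dot_gt0 w w0)) (le_trans _ (curv w)) ?dot_ge0.
have [xs_ball _] := hxstar; case: hrun => x0 gE lin search stepE.
pose r := eps / mean_weight w.
have ball1 z : owl_ball w eps z -> norm1 z <= r.
  move=> zb; rewrite ler_pdivlMr // mulrC.
  exact: le_trans (mean_weight_norm1_le_owl_norm w z hw) zb.
have x1 j : norm1 (x j) <= r.
  elim: j => [|j IH]; first exact: ball1.
  have [/= /andP[t0 t1] _] := search j; have /ball1 s1 := (lin j).1.
  rewrite stepE (_ : _ + _ = (1 - gamma j) *: x j + gamma j *: s j); last first.
    by rewrite scalerBr scalerBl scale1r addrA addrAC.
  apply: (le_trans (norm1D _ _)); rewrite !norm1Z !ger0_norm ?subr_ge0 //.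
  nra.
pose C := 4 * r ^+ 2 * L.
have diam j : L * dot (s j - x j) (s j - x j) <= C.
  rewrite /C mulrC ler_wpM2r //; apply: (le_trans (dot_le_norm1_sqr _)).
  have : norm1 (s j - x j) <= 2 * r.
    apply: (le_trans (norm1D _ _)); rewrite -scaleN1r norm1Z normrN1 mul1r.
    by have /ball1 := (lin j).1; have := x1 j; lra.
  by have := norm1_ge0 (s j - x j); nra.
have -> : 8 * eps ^+ 2 * L / (mean_weight w ^+ 2 * (k%:R + 2)) =
    2 * C / (k%:R + 2).
  rewrite /C /r; field; rewrite (gt_eqF wbar0) andbT.
  by rewrite gt_eqF // ltr_wpDl.
apply: (@frank_wolfe_rate R C
  (fun j => least_squares H y (x j) - least_squares H y xstar)) => //.
  by rewrite /C mulr_ge0 // mulr_ge0 ?sqr_ge0.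
move=> j t /andP[t0 t1].
(* Exact line search does at least as well as any fixed step [t]. *)
have opt : least_squares H y (x j.+1) <=
    least_squares H y (x j + t *: (s j - x j)).
  by rewrite stepE; apply: (search j).2; rewrite /= t0 t1.
(* Frank-Wolfe gap: convexity bounds the left side by the linear form at [xstar - x j], and [s j]
   maximizes that form over the ball containing [xstar]. *)
have gap : least_squares H y (x j) - least_squares H y xstar <=
    dot (s j - x j) (g j).
  have := (lin j).2 _ xs_ball; rewrite /= dotBl.
  have := least_squaresD H y (x j) (xstar - x j).
  rewrite addrC subrK -gE dotBl.
  by have := dot_ge0 (H *m (xstar - x j)); lra.
move: opt; rewrite least_squaresD -gE -scalemxAr !dotZl dotZr.
have := le_trans (curv _) (diam j).
set fs := least_squares H y xstar in gap *.
set f := least_squares H y (x j) in gap *.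
set a := dot _ (g j) in gap *; set b := dot (H *m _) _ => bC opt.
have : t * (f - fs) <= t * a by rewrite ler_wpM2l.
have : t ^+ 2 * b <= t ^+ 2 * C by rewrite ler_wpM2l ?sqr_ge0.
by move: opt; rewrite expr2 mulrBl; lra.
Qed.
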